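(* Let $n,m\in\mathbb N$, let $A\subset\mathbb R^n$ be open, connected and unbounded, let $X$ be a compact metric space with distance $d$, let $\kappa:\overline A\to X$ be a compactification, and let $\varphi\in\mathcal C^m(\overline A,\mathbb R^+)$. Let $F\subset\mathcal C^m_{\kappa,\varphi}(\overline A)$. Then $F$ has compact closure in $\mathcal C^m_{\kappa,\varphi}(\overline A)$ if the three following conditions are satisfied: \begin{enumerate} \item For each $x\in\overline A$ and every $p\in P_m$ there exists some constant $M_{x,p}\in\mathbb R^+$ such that $\left|\partial_p(f/\varphi)(x)\right|\le M_{x,p}$ for all $f\in F$. \item For every $x\in\overline A$, $\varepsilon\in\mathbb R^+$ and $p\in P_m$ there exists some $\delta_{x,p}\in\mathbb R^+$ such that $\left|\partial_p(f/\varphi)(x)-\partial_p(f/\varphi)(y)\right|<\varepsilon$ if $f\in F$ and $y\in\overline A$ is such that $\|x-y\|<\delta_{x,p}$. \item For every $x\in X\setminus\kappa(\overline A)$, $\varepsilon\in\mathbb R^+$ and $p\in P_m$ there exists some $\delta_{x,p}\in\mathbb R^+$ such that $\left|\lim_{z\to x}^{\kappa}\partial_p(f/\varphi)(z)-\partial_p(f/\varphi)(y)\right|<\varepsilon$ if $f\in F$ and $y\in\overline A$ is such that $d(x,\kappa(y))<\delta_{x,p}$. \end{enumerate}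
   Context: $\mathbb R^+=(0,\infty)$. A continuous map $\kappa:S\to Y$ from a topological space $S$ to a compact topological space $Y$ is a compactification of $S$ if $\kappa(S)$ is dense in $Y$ and $\kappa:S\to\kappa(S)$ is a homeomorphism. For a compactification $\kappa:S\to Y$, a function $g:S\to Z$ with $Z$ Hausdorff, and $y\in Y\setminus\kappa(S)$, one writes $\lim_{x\to y}^{\kappa}g(x)=z$ if for every neighborhood $V$ of $z$ in $Z$ there is a neighborhood $U$ of $y$ in $Y$ with $g(\kappa^{-1}(U\setminus\{y\}))\subset V$. For a multi-index $p=(p_1,\dots,p_n)\in(\{0\}\cup\mathbb N)^n$, $|p|=\sum_j p_j$ and $\partial_p=\partial^{|p|}/\partial x_1^{p_1}\cdots\partial x_n^{p_n}$; $P_m=\{p\in(\{0\}\cup\mathbb N)^n: |p|\le m\}$. $\mathcal C^m(\overline A,\cdot)$ denotes $m$-times continuously differentiable functions on $\overline A$. Define $$\mathcal C^m_{\kappa,\varphi}(\overline A)=\left\{f\in\mathcal C^m(\overline A,\mathbb R):\ \lim_{y\to x}{}^{\kappa}\,\partial_p(f/\varphi)(y)\text{ exists in }\mathbb R\text{ for all }x\in X\setminus\kappa(\overline A),\ p\in P_m\right\},$$ with the norm $\|f\|_{\kappa,\varphi}=\max\{\|\partial_p(f/\varphi)\|_\infty:\ p\in P_m\}$. *)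

(* Defs.v *)
From HB Require Import structures.
From mathcomp Require Import all_boot all_order all_algebra.
From mathcomp Require Import all_classical all_reals.
From mathcomp Require Import topology tvs normedtype derive.

Set Implicit Arguments.
Unset Strict Implicit.
Unset Printing Implicit Defensive.

Import Order.TTheory GRing.Theory Num.Theory.
Import numFieldTopology.Exports numFieldNormedType.Exports.

Local Open Scope classical_set_scope.
Local Open Scope ring_scope.

Section compactification.
Context {S Y : topologicalType}.

Definition homeomorphism_onto_image (kappa : S -> Y) :=
  continuous kappa /\
  exists2 g : range kappa -> S, continuous g &
    forall (s : S) (t : range kappa), val t = kappa s -> g t = s.

Definition compactification (kappa : S -> Y) :=
  [/\ compact [set: Y], dense (range kappa) & homeomorphism_onto_image kappa].

(* [g @ kappa_nbhs kappa y --> z] unfolds to: for every neighborhood V of z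
   there is a neighborhood U of y with g (kappa^-1 (U \ {y})) included in V. *)
Definition kappa_nbhs (kappa : S -> Y) (y : Y) : set_system S :=
  filter_from (nbhs y) (fun U => kappa @^-1` (U `\ y)).

Global Instance kappa_nbhs_filter (kappa : S -> Y) y :
  Filter (kappa_nbhs kappa y).
Proof.
apply: filter_from_filter; first by exists setT; exact: filterT.
move=> U V nU nV; exists (U `&` V); first exact: filterI.
by move=> s [[Us Vs] sy]; split.
Qed.

End compactification.

(* P_m: the entries of a multi-index p with |p| <= m are at most m. *)
Definition multiindex (n m : nat) :=
  {p : {ffun 'I_n -> 'I_m.+1} | (\sum_i p i <= m)%N}.

Definition directions n m (p : multiindex n m) : seq 'I_n :=
  flatten [seq nseq (val p i) i | i <- enum 'I_n].

Section derivatives.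
Context {R : realType} {n : nat} (A : set 'rV[R]_n).
Implicit Types (f g : closure A -> R) (F G : 'rV[R]_n -> R).

Definition euclidean_norm (x : 'rV[R]_n) : R :=
  Num.sqrt (\sum_i (x ord0 i) ^+ 2).

(* iter_partial [:: i1; ...; ik] F is d/dx_i1 (... (d/dx_ik F)). *)
Definition iter_partial (s : seq 'I_n) F : 'rV[R]_n -> R :=
  foldr (fun i G x => 'D_(delta_mx ord0 i) G x) F s.

Definition extends_to_closure F :=
  exists2 g : closure A -> R, continuous g &
    forall x : closure A, A (val x) -> g x = F (val x).

(* C^m(\overline A): f is continuous on the closure, and the iterated partial
   derivatives of order at most m exist in A and extend continuously to the
   closure. Here 'valL_0 f is f extended by 0 outside the closure. *)
Definition Cm (m : nat) f :=
  continuous f /\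
  forall s : seq 'I_n, (size s <= m)%N ->
    extends_to_closure (iter_partial s ('valL_0 f)) /\
    ((size s < m)%N -> forall i x, A x ->
       derivable (iter_partial s ('valL_0 f)) x (delta_mx ord0 i)).

Definition Cm_pos m f := Cm m f /\ forall x, 0 < f x.

(* On the boundary of A the derivative is the value of the continuous extension
   of the derivative in A. *)
Definition partial_seq (s : seq 'I_n) f : closure A -> R :=
  fun x => lim (iter_partial s ('valL_0 f) @ within A (nbhs (val x))).

Definition partial m (p : multiindex n m) f : closure A -> R :=
  partial_seq (directions p) f.

Definition supnorm f : R := sup (range (fun x => `|f x|)).

End derivatives.

Section calculus.
Context {R : realType} {n : nat} (A : set 'rV[R]_n) (oA : open A).
Implicit Types (f g : closure A -> R) (F G : 'rV[R]_n -> R).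

Let e (i : 'I_n) : 'rV[R]_n := delta_mx ord0 i.

Let ext F := extends_to_closure A F.

Let extD F G : ext F -> ext G -> ext (fun x => F x + G x).
Proof.
move=> [f cf fF] [g cg gG]; exists (fun x => f x + g x).
  by move=> x; exact: cvgD (cf x) (cg x).
by move=> x Ax; rewrite fF// gG.
Qed.

Let extM F G : ext F -> ext G -> ext (fun x => F x * G x).
Proof.
move=> [f cf fF] [g cg gG]; exists (fun x => f x * g x).
  by move=> x; exact: cvgM (cf x) (cg x).
by move=> x Ax; rewrite fF// gG.
Qed.

Let extC (c : R) : ext (fun=> c).
Proof. by exists (fun=> c) => // x; exact: cst_continuous. Qed.

Let ext_eq F G : (forall x, A x -> F x = G x) -> ext F -> ext G.
Proof. by move=> FG [f cf fF]; exists f => // x Ax; rewrite fF// FG. Qed.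

Let eq_near F G : (forall x, A x -> F x = G x) ->
  forall x, A x -> \forall y \near x, F y = G y.
Proof.
by move=> FG x Ax; near=> y; apply: FG; near: y; exact: open_nbhs_nbhs.
Unshelve. all: by end_near. Qed.

Lemma eq_iter_partial s F G : (forall x, A x -> F x = G x) ->
  forall x, A x -> iter_partial s F x = iter_partial s G x.
Proof.
move=> FG; elim: s => [|i s IH] //= x Ax.
by apply: near_eq_derive; exact: eq_near.
Qed.

Fixpoint smooth m F : Prop := ext F /\
  if m is k.+1 then
    forall i, (forall x, A x -> derivable F x (e i)) /\ smooth k ('D_(e i) F)
  else True.

Lemma smooth_ext m F : smooth m F -> ext F.
Proof. by case: m => [|m] []. Qed.

Lemma smoothS m F : smooth m.+1 F -> smooth m F.
Proof.
elim: m F => [|m IH] F; first by case.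
by move=> [? sF]; split => // i; have [? ?] := sF i; split => //; exact: IH.
Qed.

Lemma eq_smooth m F G : (forall x, A x -> F x = G x) -> smooth m F ->
  smooth m G.
Proof.
elim: m F G => [|m IH] F G FG [eF sF]; split => //; try exact: ext_eq eF.
move=> i; have [dF sDF] := sF i; split.
  by move=> x Ax; apply: near_eq_derivable (dF _ Ax); exact: eq_near.
by apply: IH sDF => x Ax; apply: near_eq_derive; exact: eq_near.
Qed.

Lemma smooth_cst m (c : R) : smooth m (fun=> c).
Proof.
elim: m c => [|m IH] c; first by split.
split => // i; split; first by move=> x _; exact: derivable_cst.
by apply: eq_smooth (IH 0) => x _; rewrite derive_cst.
Qed.

Lemma smoothD m F G : smooth m F -> smooth m G ->
  smooth m (fun x => F x + G x).
Proof.
elim: m F G => [|m IH] F G [eF sF] [eG sG]; split => //; try exact: extD.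
move=> i; have [dF sDF] := sF i; have [dG sDG] := sG i; split.
  by move=> x Ax; apply: derivableD; [exact: dF|exact: dG].
apply: eq_smooth (IH _ _ sDF sDG) => x Ax.
by rewrite -deriveD//; [exact: dF|exact: dG].
Qed.

Lemma smoothM m F G : smooth m F -> smooth m G ->
  smooth m (fun x => F x * G x).
Proof.
elim: m F G => [|m IH] F G.
  by move=> [eF _] [eG _]; split => //; exact: extM.
move=> sF sG; have [[eF dF] [eG dG]] := (sF, sG); split; first exact: extM.
move=> i; split.
  by move=> x Ax; apply: derivableM; [apply: (dF i).1|apply: (dG i).1].
apply: eq_smooth (smoothD (IH _ _ (smoothS sF) (dG i).2)
                          (IH _ _ (smoothS sG) (dF i).2)) => x Ax.
by rewrite [RHS](deriveM ((dF i).1 _ Ax) ((dG i).1 _ Ax)).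
Qed.

Lemma smoothV m F (g : closure A -> R) : continuous g ->
  (forall x : closure A, A (val x) -> g x = F (val x)) ->
  (forall x, g x != 0) -> smooth m F -> smooth m (fun x => (F x)^-1).
Proof.
move=> cg gF g0; have eV : ext (fun x => (F x)^-1).
  exists (fun x => (g x)^-1); first by move=> x; exact: (cvgV (g0 x) (cg x)).
  by move=> x Ax; rewrite gF.
have F0 x : A x -> F x != 0.
  move=> Ax; have cAx : x \in closure A by apply/mem_set/subset_closure.
  by have := gF (SigSub cAx) Ax; move=> /= <-.
elim: m => [|m IH] sF; first by split.
have sV := IH (smoothS sF); case: sF => eF dF; split => // i; split.
  by move=> x Ax; apply: derivableV; [exact: F0|apply: (dF i).1].
apply: eq_smooth (smoothM (smooth_cst m (-1))
  (smoothM (smoothM sV sV) (dF i).2)) => x Ax.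
rewrite [RHS](deriveV (F0 _ Ax) ((dF i).1 _ Ax)) mulN1r -exprVn expr2.
by rewrite scaleNr.
Qed.

Lemma Cm_smooth m f : Cm m f <-> continuous f /\ smooth m ('valL_0 f).
Proof.
split=> -[cf sf]; split=> //; move: ('valL_0 f) sf => F {cf f}.
  elim: m F => [|m IH] F sF; first by have [] := sF [::].
  split; first by have [] := sF [::].
  move=> i; split; first by have [_] := sF [::] isT; exact.
  apply: IH => s sm; have := sF (rcons s i).
  by rewrite size_rcons /iter_partial foldr_rcons; exact.
elim: m F => [|m IH] F sF s.
  by rewrite leqn0 size_eq0 => /eqP->; split => //; case: sF.
elim/last_ind: s => [_|s i _].
  by case: sF => eF dF; split => // _ i; exact: (dF i).1.
case: sF => _ /(_ i) [_ /IH] /(_ s).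
by rewrite size_rcons ltnS /iter_partial foldr_rcons.
Qed.

Lemma valL0E f (x : closure A) : 'valL_0 f (val x) = f x.
Proof. by have /(congr1 (@^~ x)) := valLK 0 f. Qed.

Lemma valL0_eq f F : (forall x : closure A, f x = F (val x)) ->
  forall x, A x -> 'valL_0 f x = F x.
Proof.
move=> fF x Ax; have cAx : x \in closure A by apply/mem_set/subset_closure.
by rewrite (valL0E f (SigSub cAx)) fF.
Qed.

Lemma CmZD m (c : R) f g : Cm m f -> Cm m g -> Cm m (fun x => c * f x + g x).
Proof.
rewrite !Cm_smooth => -[cf sf] [cg sg]; split.
  have cc : continuous ((fun=> c) : closure A -> R).
    by move=> x; exact: cst_continuous.
  by move=> x; exact: cvgD (cvgM (cc x) (cf x)) (cg x).
apply: eq_smooth (smoothD (smoothM (smooth_cst m c) sf) sg) => x Ax.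
rewrite [RHS](@valL0_eq _ (fun x => c * 'valL_0 f x + 'valL_0 g x))// => y.
by rewrite !valL0E.
Qed.

Lemma Cm_div m f g : Cm m f -> Cm_pos m g -> Cm m (fun x => f x / g x).
Proof.
move=> cmf [cmg g_gt0]; move: cmf cmg; rewrite !Cm_smooth => -[cf sf] [cg sg].
have g0 x : g x != 0 by rewrite gt_eqF.
split.
  by move=> x; exact: cvgM (cf x) (cvgV (g0 x) (cg x)).
have sV := smoothV cg (fun x _ => esym (valL0E g x)) g0 sg.
apply: eq_smooth (smoothM sf sV) => x Ax.
rewrite [RHS](@valL0_eq _ (fun x => 'valL_0 f x / 'valL_0 g x))// => y.
by rewrite !valL0E.
Qed.

Lemma partial_seq_uniq s f g : continuous g ->
  (forall x : closure A, A (val x) -> g x = iter_partial s ('valL_0 f) (val x)) ->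
  partial_seq s f = g.
Proof.
move=> cg gf; apply/funext => x; apply: cvg_lim => //.
  by apply: within_nbhs_proper; have := valP x; rewrite inE.
move=> V /cg [W [[O oO OW] Wx WV]].
have : nbhs (val x) O.
  by apply: open_nbhs_nbhs; split => //; rewrite -OW in Wx.
apply: filterS => y Oy Ay.
have cAy : y \in closure A by apply/mem_set/subset_closure.
have := WV (SigSub cAy); rewrite -OW /= gf//; exact.
Qed.

Lemma Cm_partial_seq m f s : Cm m f -> (size s <= m)%N ->
  continuous (partial_seq s f) /\
  forall x : closure A, A (val x) ->
    partial_seq s f x = iter_partial s ('valL_0 f) (val x).
Proof. by move=> [_ cf] /cf [[g cg gf] _]; rewrite (partial_seq_uniq cg). Qed.

Lemma partial_seq_nil f : continuous f -> partial_seq [::] f = f.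
Proof. by move=> cf; apply: partial_seq_uniq => // x _; exact/esym/valL0E. Qed.

Lemma partial_seqZD m (c : R) f g s : Cm m f -> Cm m g -> (size s <= m)%N ->
  partial_seq s (fun x => c * f x + g x) =
  (fun x => c * partial_seq s f x + partial_seq s g x).
Proof.
move=> cf cg sm; have [cpf pf] := Cm_partial_seq cf sm.
have [cpg pg] := Cm_partial_seq cg sm.
apply: partial_seq_uniq.
  have cc : continuous ((fun=> c) : closure A -> R).
    by move=> x; exact: cst_continuous.
  by move=> x; exact: cvgD (cvgM (cc x) (cpf x)) (cpg x).
move=> x Ax; rewrite pf// pg//.
have E y : A y ->
    'valL_0 (fun x => c * f x + g x) y = c * 'valL_0 f y + 'valL_0 g y.
  by apply: (@valL0_eq _ (fun y => c * 'valL_0 f y + 'valL_0 g y)) => z;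
     rewrite !valL0E.
rewrite (eq_iter_partial s E Ax) => {E pf pg cpf cpg}.
have [[_ +] [_ +]] := (cf, cg); move: ('valL_0 f) ('valL_0 g) => F G sf sg.
apply/esym; elim: s sm (val x) Ax => [//|i s IH] /= sm y Ay.
have [_ /(_ sm i _ Ay) df] := sf _ (ltnW sm).
have [_ /(_ sm i _ Ay) dg] := sg _ (ltnW sm).
transitivity ('D_(e i) (c *: iter_partial s F + iter_partial s G) y).
  by apply: near_eq_derive; apply: eq_near => // z Az; rewrite IH// ltnW.
by rewrite deriveD ?deriveZ//; exact: derivableZ.
Qed.

Lemma size_directions m (p : multiindex n m) :
  (size (directions p) <= m)%N.
Proof.
rewrite size_flatten /shape -map_comp sumnE big_map big_enum /=.
by under eq_bigr do rewrite size_nseq; exact: (valP p).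
Qed.

Lemma multiindex0_subproof m : (\sum_i [ffun=> ord0 : 'I_m.+1] (i : 'I_n) <= m)%N.
Proof. by rewrite big1// => i _; rewrite ffunE. Qed.

Definition multiindex0 m : multiindex n m := 
  exist _ [ffun=> ord0] (multiindex0_subproof m).

Lemma directions0 m : directions (multiindex0 m) = [::].
Proof.
rewrite /directions; elim: (enum _) => [//|i s IH] /=.
by rewrite IH ffunE.
Qed.

End calculus.

Section space.
Context {R : realType} {n m : nat} {A : set 'rV[R]_n} {X : metricType R}.
Context {kappa : closure A -> X} {phi : closure A -> R}.
Variables (oA : open A) (kappaP : compactification kappa)
  (phiP : Cm_pos m phi).
Implicit Types f g : closure A -> R.

(* The hypotheses are arguments of the set, and so of the type [Ckphi] below,
   because the normed space structure on this type depends on them. *)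
Definition Ckphi_set of open A & compactification kappa & Cm_pos m phi :
    {pred (closure A -> R)} :=
  mem [set f : closure A -> R | Cm m f /\
    forall x : X, ~ range kappa x -> forall p : multiindex n m,
      cvg (partial p (fun y => f y / phi y) @ kappa_nbhs kappa x)].

Record Ckphi := MkCkphi {
  Ckphi_fun :> closure A -> R;
  _ : Ckphi_fun \in Ckphi_set oA kappaP phiP }.

HB.instance Definition _ := [isSub for Ckphi_fun].
HB.instance Definition _ := [Choice of Ckphi by <:].

Let q f : closure A -> R := fun y => f y / phi y.

Let qZD c f g : q (c *: f + g) = (fun x => c * q f x + q g x).
Proof. by apply/funext => x; rewrite /q /= mulrDl mulrA. Qed.

Let partialqZD (p : multiindex n m) c f g : Cm m f -> Cm m g ->
  partial p (q (c *: f + g)) = fun x => c * partial p (q f) x + partial p (q g) x.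
Proof.
move=> cf cg; rewrite qZD; apply: (@partial_seqZD _ _ _ oA m).
- exact: Cm_div.
- exact: Cm_div.
- exact: size_directions.
Qed.

Let Cm0 : Cm m (0 : closure A -> R).
Proof.
apply/Cm_smooth; split; first by move=> x; exact: cst_continuous.
apply: (eq_smooth oA _ (smooth_cst oA m 0)) => x Ax.
by apply/esym; apply: (@valL0_eq _ _ _ 0 (fun=> 0)).
Qed.

Lemma Ckphi_submod_closed : submod_closed (Ckphi_set oA kappaP phiP).
Proof.
split.
  apply/mem_set; split; first exact: Cm0.
  move=> x _ p; have -> : partial p (q 0) = fun=> 0.
    have := @partialqZD p (-1) 0 0 Cm0 Cm0; rewrite scaler0 addr0 => ->.
    by apply/funext => y; rewrite mulN1r addNr.
  exact: is_cvg_cst.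
move=> c f g /set_mem[cf lf] /set_mem[cg lg]; apply/mem_set; split.
  exact: CmZD.
move=> x kx p; have -> := partialqZD p c cf cg.
apply: is_cvgD; last exact: lg.
by apply: is_cvgM; [exact: is_cvg_cst|exact: lf].
Qed.

HB.instance Definition _ := GRing.isSubmodClosed.Build R (closure A -> R)
  (Ckphi_set oA kappaP phiP) Ckphi_submod_closed.
HB.instance Definition _ := [SubChoice_isSubLmodule of Ckphi by <:].

Definition Ckphi_norm (f : Ckphi) : R :=
  \big[Num.max/0]_(p : multiindex n m)
    supnorm (partial p (fun y => f y / phi y)).

Let CkphiP (f : Ckphi) : Cm m f /\ forall x : X, ~ range kappa x ->
  forall p : multiindex n m, cvg (partial p (q f) @ kappa_nbhs kappa x).
Proof. by case: f => f /= /set_mem. Qed.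

Let bnd (f : Ckphi) (p : multiindex n m) :
  exists M, forall x, `|partial p (q f) x| <= M.
Proof.
have [cf lf] := CkphiP f.
have [ch _] := Cm_partial_seq (Cm_div oA cf phiP) (size_directions p).
rewrite -/(partial p (q f)) in ch; set h := partial p (q f) in ch *.
have [cX _ [ck [g cg gk]]] := kappaP.
have nbhsl (l : R) : nbhs l [set r : R | `|r| <= `|l| + 1].
  apply/nbhs_ballP; exists 1 => //= r /ltW lr /=.
  by rewrite -lerBlDl (le_trans (lerB_dist _ _))// distrC.
suff H : forall y : X, exists M, exists2 U, nbhs y U &
    forall a, U (kappa a) -> `|h a| <= M.
  move/compact_near_coveringP : cX.
  move/(_ R +oo (fun M y => forall a, kappa a = y -> `|h a| <= M) _).
  case=> [y _|M [_ MP]].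
    have [M [U nU UM]] := H y; exists (U, [set r | M <= r]) => /=.
      by split => //; by apply: nbhs_pinfty_ge; exact: num_real.
    by move=> [z r] /= [Uz Mr] a az; rewrite (le_trans _ Mr)// UM// az.
  by exists (M + 1) => x; apply: (MP (M + 1)) => //; rewrite ltrDl.
move=> y; have [[a _ <-{y}]|ny] := pselect (range kappa y).
  have rk b : kappa b \in range kappa by apply/mem_set; exists b.
  have : nbhs a [set b | `|h b| <= `|h a| + 1] by exact: (ch a _ (nbhsl (h a))).
  rewrite -{1}(gk a (SigSub (rk a)) erefl) => /cg [W [[O oO OW] Wx WV]].
  exists (`|h a| + 1), O.
    by apply: open_nbhs_nbhs; split => //; rewrite -OW in Wx.
  move=> b Ob; have := WV (SigSub (rk b)); rewrite -OW/= (gk b)//; exact.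
have /cvg_ex[l hl] := lf y ny p.
have /hl[U nU UV] := nbhsl l; exists (`|l| + 1), U => // a Ua.
by apply: UV; split => // ay; apply: ny; exists a.
Qed.

Let le_supnorm (f : Ckphi) (p : multiindex n m) x :
  `|partial p (q f) x| <= supnorm (partial p (q f)).
Proof.
apply: ub_le_sup; last by exists x.
by have [M fM] := bnd f p; exists M => _ [y _ <-].
Qed.

Let le_norm (f : Ckphi) (p : multiindex n m) x :
  `|partial p (q f) x| <= Ckphi_norm f.
Proof. by apply: (le_trans (le_supnorm f p x)); exact: le_bigmax. Qed.

Let norm_ge0 (f : Ckphi) : 0 <= Ckphi_norm f.
Proof. exact: bigmax_ge_id. Qed.

Let norm_le (f : Ckphi) (M : R) : 0 <= M ->
  (forall (p : multiindex n m) x, `|partial p (q f) x| <= M) -> Ckphi_norm f <= M.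
Proof.
move=> M0 fM; apply: bigmax_le => // p _.
have [[_ [x _ _]]|/nonemptyPn s0] :=
    pselect (range (fun x => `|partial p (q f) x|) !=set0).
  apply: ge_sup => [|_ [y _ <-]]; last exact: fM.
  by exists `|partial p (q f) x|, x.
by rewrite /supnorm s0 sup0.
Qed.

Let ler_normD (f g : Ckphi) : Ckphi_norm (f + g) <= Ckphi_norm f + Ckphi_norm g.
Proof.
apply: norm_le => [|p x]; first exact: addr_ge0.
have := partialqZD p 1 (CkphiP f).1 (CkphiP g).1; rewrite scale1r => ->.
by rewrite mul1r (le_trans (ler_normD _ _))// lerD.
Qed.

Let partialqZ (p : multiindex n m) c (f : Ckphi) x :
  partial p (q (c *: f : Ckphi)) x = c * partial p (q f) x.
Proof.
have := partialqZD p (c - 1) (CkphiP f).1 (CkphiP f).1.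
rewrite scalerBl scale1r subrK => ->.
by rewrite mulrBl mul1r subrK.
Qed.

Let normrZ c (f : Ckphi) : Ckphi_norm (c *: f) = `|c| * Ckphi_norm f.
Proof.
have le d (g : Ckphi) : Ckphi_norm (d *: g) <= `|d| * Ckphi_norm g.
  apply: norm_le => [|p x]; first exact: mulr_ge0.
  by rewrite partialqZ normrM ler_wpM2l.
apply/eqP; rewrite eq_le le /=.
have [->|c0] := eqVneq c 0; first by rewrite normr0 mul0r.
rewrite -ler_pdivlMl ?normr_gt0// -normfV.
by have := le c^-1 (c *: f); rewrite scalerA mulVf// scale1r.
Qed.

Let normr0_eq0 (f : Ckphi) : Ckphi_norm f = 0 -> f = 0.
Proof.
move=> f0; apply/val_inj/funext => x /=.
have [cf _] := CkphiP f.
have := le_norm f (multiindex0 m) x.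
rewrite f0 normr_le0 /partial directions0 partial_seq_nil; last first.
  by have [] := Cm_div oA cf phiP.
rewrite mulf_eq0 invr_eq0 => /orP[/eqP//|].
by rewrite gt_eqF//; case: phiP.
Qed.

HB.instance Definition _ := Lmodule_isNormed.Build R Ckphi
  ler_normD normrZ normr0_eq0.

End space.

(* Main.v *)
(* Arzela-Ascoli with ultrafilters. Let U be an ultrafilter on the space that
   contains the closure of F. Condition 1 makes every derivative of f / phi
   converge pointwise along U. Conditions 2 and 3 say that near each point of X
   the derivatives of f / phi oscillate little, uniformly in f, so by
   compactness of X the convergence is uniform. By the mean value theorem the
   limits of the derivatives are the derivatives of the limit h, so phi h
   belongs to the space and U converges to it. The norm only controls the
   derivatives taken in increasing order of the variables, while membership in
   C^m concerns all orders; symmetry of mixed derivatives bridges the gap. *)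
Require Import Defs.
From mathcomp Require Import all_boot all_order all_algebra.
From mathcomp Require Import all_classical all_reals.
From mathcomp Require Import topology tvs normedtype derive realfun.
From mathcomp Require Import lra.

Set Implicit Arguments.
Unset Strict Implicit.
Unset Printing Implicit Defensive.

Import Order.TTheory GRing.Theory Num.Theory.
Import numFieldTopology.Exports numFieldNormedType.Exports.

Local Open Scope classical_set_scope.
Local Open Scope ring_scope.

(** * Triangle inequalities and the mean value theorem on a segment *)

Lemma ler_dist2 {R : realFieldType} (l a b e : R) :
  `|l - a| <= e / 2 -> `|l - b| <= e / 2 -> `|a - b| <= e.
Proof.
rewrite !ler_norml => /andP[? ?] /andP[? ?]; apply/andP; lra.
Qed.

Lemma ler_dist3 {R : realFieldType} (a b c d e : R) :
  `|a - c| <= e / 3 -> `|b - d| <= e / 3 -> `|c - d| <= e / 3 -> `|a - b| <= e.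
Proof.
rewrite !ler_norml => /andP[? ?] /andP[? ?] /andP[? ?]; apply/andP; lra.
Qed.

Lemma mvt_segment {R : realType} (f df : R -> R) (a b : R) : a <= b ->
  (forall s, s \in `[a, b]%R -> is_derive s 1 f (df s)) ->
  exists2 s, s \in `[a, b]%R & f b - f a = df s * (b - a).
Proof.
move=> ab dfE.
have fo s : s \in `]a, b[%R -> is_derive s 1 f (df s).
  by move=> /subset_itv_oo_cc; exact: dfE.
have fc : {within `[a, b], continuous f}.
  by apply: derivable_within_continuous => s /dfE[].
by have [c cab E] := MVT_segment ab fo fc; exists c.
Qed.

(** * Directional derivatives: mean value theorem, symmetry, passage to the limit *)

Section directional_derivatives.
Context {R : realType} {V : normedModType R}.
Implicit Types (F : V -> R) (x u v : V).

Lemma is_derive_line F x u (s : R) : derivable F (x + s *: u) u ->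
  is_derive s 1 (fun r : R => F (x + r *: u)) ('D_u F (x + s *: u)).
Proof.
move=> dF; have E : (fun h : R => h^-1 *:
      (((fun r : R => F (x + r *: u)) \o shift s) (h *: 1) - F (x + s *: u))) =
    (fun h : R => h^-1 *:
      ((F \o shift (x + s *: u)) (h *: u) - F (x + s *: u))).
  apply/funext => h /=; congr (_ *: (F _ - _)).
  by rewrite [h *: 1]mulr1 scalerDl addrCA.
by split; rewrite /derivable /derive E.
Qed.

(** The bound [|s| <= |t|] serves both signs of [t]: the one-variable theorem is applied on [[0, t]]
    or on [[t, 0]]. *)
Lemma mvt_line F x u (t : R) :
  (forall s : R, `|s| <= `|t| -> derivable F (x + s *: u) u) ->
  exists2 s : R, `|s| <= `|t| &
    F (x + t *: u) - F x = t * 'D_u F (x + s *: u).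
Proof.
move=> dF.
have seg (a b : R) : a <= b -> (forall s, s \in `[a, b]%R -> `|s| <= `|t|) ->
    exists2 s, `|s| <= `|t| &
      F (x + b *: u) - F (x + a *: u) = (b - a) * 'D_u F (x + s *: u).
  move=> ab abt.
  have [|s] := @mvt_segment R (fun r : R => F (x + r *: u))
      (fun s => 'D_u F (x + s *: u)) a b ab.
    by move=> s sab; apply: is_derive_line; apply: dF; exact: abt.
  by move=> /abt st E; exists s => //; rewrite [RHS]mulrC -E.
have [t0|t0] := leP 0 t.
  have [s|s st] := seg 0 t t0.
    by rewrite in_itv/= => /andP[? ?]; rewrite !ger0_norm.
  by rewrite scale0r addr0 subr0 => ->; exists s.
have [s|s st] := seg t 0 (ltW t0).
  by rewrite in_itv/= => /andP[? ?]; rewrite !ler0_norm ?lerN2// ltW.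
rewrite scale0r addr0 sub0r mulNr => /(congr1 -%R).
by rewrite opprB opprK => ->; exists s.
Qed.

Lemma near_parallelogram (P : set V) x u v : nbhs x P ->
  exists2 t : R, 0 < t & forall a b : R, `|a| <= t -> `|b| <= t ->
    P (x + a *: u + b *: v).
Proof.
(* The summand 1 keeps [N] positive when [u = v = 0] and makes the final estimate strict. *)
move=> /nbhs_normP[r /= r0 rP]; pose N := `|u| + `|v| + 1.
have N0 : 0 < N by rewrite ltr_wpDl ?addr_ge0.
exists (r / N); first exact: divr_gt0.
move=> a b at_ bt; apply: rP => /=.
rewrite -addrA opprD addNKr normrN (le_lt_trans (ler_normD _ _))// !normrZ.
have -> : r = r / N * `|u| + r / N * `|v| + r / N.
  by rewrite -!mulrDr -/N -{2}[r / N]mulr1 -mulrDr -/N divfK ?gt_eqF.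
rewrite ltr_pwDr ?divr_gt0// lerD// ler_wpM2r//.
Qed.

Lemma near_segment (P : set V) x u : nbhs x P ->
  exists2 t : R, 0 < t & forall a : R, `|a| <= t -> P (x + a *: u).
Proof.
move=> xP; have [t t0 tP] := near_parallelogram u 0 xP; exists t => // a at_.
by have := tP a 0 at_; rewrite normr0 scaler0 addr0; apply; exact: ltW.
Qed.

(* The left-hand side is symmetric under exchanging u and v, which is why mixed
   derivatives commute. *)
Lemma second_difference F x u v (t : R) : 0 < t ->
  (forall a b : R, `|a| <= t -> `|b| <= t ->
    derivable F (x + a *: u + b *: v) u /\
    derivable ('D_u F) (x + a *: u + b *: v) v) ->
  exists a b : R, [/\ `|a| <= t, `|b| <= t &
    F (x + t *: u + t *: v) - F (x + t *: u) - (F (x + t *: v) - F x) =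
    t * (t * 'D_v ('D_u F) (x + a *: u + b *: v))].
Proof.
move=> t0 dF; have tt : `|t| = t by rewrite gtr0_norm.
have dF0 a : `|a| <= t -> derivable F (x + a *: u) u.
  move=> at_; have [|+ _] := dF a 0 at_; first by rewrite normr0 ltW.
  by rewrite scale0r addr0.
have dFt a : `|a| <= t -> derivable (fun y => F (y + t *: v)) (x + a *: u) u /\
    'D_u (fun y => F (y + t *: v)) (x + a *: u) = 'D_u F (x + a *: u + t *: v).
  move=> at_; have [|d _] := dF a t at_; first by rewrite tt.
  have E : (fun h : R => h^-1 *:
      (((fun y => F (y + t *: v)) \o shift (x + a *: u)) (h *: u) -
       F (x + a *: u + t *: v))) =
    (fun h : R => h^-1 *:
      ((F \o shift (x + a *: u + t *: v)) (h *: u) - F (x + a *: u + t *: v))).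
    by apply/funext => h /=; rewrite !addrA.
  by split; rewrite /derivable /derive E.
(* The mean value theorem is used twice: along [u] for the increment of [F] by [t *: v], then along
   [v] for ['D_u F]. *)
have [|a] := @mvt_line ((fun y => F (y + t *: v)) - F) x u t.
  rewrite tt => a at_; apply: derivableB; [exact: (dFt a at_).1|exact: dF0].
rewrite tt => at_; rewrite deriveB; [|exact: (dFt a at_).1|exact: dF0].
rewrite (dFt a at_).2.
have [|b] := @mvt_line ('D_u F) (x + a *: u) v t.
  by rewrite tt => b bt; exact: (dF a b at_ bt).2.
rewrite tt => bt -> E; by exists a, b; split => //; rewrite -E.
Qed.

(** Expanding one second difference in both orders shows that the two mixed derivatives agree at two
    points of an arbitrarily small parallelogram around [x]; continuity at [x] does the rest. *)
Lemma derive_comm F x u v :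
  (\forall y \near x, [/\ derivable F y u, derivable F y v,
    derivable ('D_u F) y v & derivable ('D_v F) y u]) ->
  {for x, continuous ('D_v ('D_u F))} -> {for x, continuous ('D_u ('D_v F))} ->
  'D_v ('D_u F) x = 'D_u ('D_v F) x.
Proof.
move=> dF /cvgrPdist_le cvu /cvgrPdist_le cuv.
apply/eqP; rewrite -subr_eq0 -normr_le0; apply/ler_addgt0Pr => e e0.
rewrite add0r.
have e2 : 0 < e / 2 by rewrite divr_gt0.
have [t t0 tP] :=
  near_parallelogram u v (filterI dF (filterI (cvu _ e2) (cuv _ e2))).
have [a [b [at_ bt E]]] : exists a b : R, [/\ `|a| <= t, `|b| <= t &
    F (x + t *: u + t *: v) - F (x + t *: u) - (F (x + t *: v) - F x) =
    t * (t * 'D_v ('D_u F) (x + a *: u + b *: v))].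
  by apply: second_difference => // a b at_ bt; have [[]] := tP a b at_ bt.
have [c [d [ct dt]]] : exists c d : R, [/\ `|c| <= t, `|d| <= t &
    F (x + t *: v + t *: u) - F (x + t *: v) - (F (x + t *: u) - F x) =
    t * (t * 'D_u ('D_v F) (x + c *: v + d *: u))].
  apply: second_difference => // c d ct dt; have [[]] := tP d c dt ct.
  by rewrite -!addrA [d *: u + _]addrC.
rewrite [x + t *: v + t *: u]addrAC [x + c *: v + d *: u]addrAC => E'.
have {E E'} : 'D_v ('D_u F) (x + a *: u + b *: v) =
    'D_u ('D_v F) (x + d *: u + c *: v).
  have cancel (l p q : R) : l = t * (t * p) -> l = t * (t * q) -> p = q.
    by move=> -> /(mulfI (lt0r_neq0 t0))/(mulfI (lt0r_neq0 t0)).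
  apply: cancel E _; rewrite -E'.
  by rewrite opprD addrACA -opprD.
have [_ [+ _]] := tP a b at_ bt; have [_ [_ +]] := tP d c dt ct.
move: ('D_v _ _) ('D_u _ _) ('D_u _ _) ('D_v _ _) => p q r s.
rewrite !ler_norml => /andP[? ?] /andP[? ?] ?; apply/andP; lra.
Qed.

(** The mean value theorem turns uniform convergence of the derivatives into a bound on the
    increments of [f i] whose admissible [t] do not depend on [i]. The limit along [U] is taken at
    fixed [t], before [t] tends to 0. *)
Lemma is_derive_limit {T : Type} (U : set_system T) {UF : ProperFilter U}
    (A : set V) (f : T -> V -> R) (g h : V -> R) x u : open A -> A x ->
  (forall y, A y -> f ^~ y @ U --> g y) ->
  (forall i y, A y -> derivable (f i) y u) ->
  (forall e : R, 0 < e -> \forall i \near U, forall y, A y ->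
    `|'D_u (f i) y - h y| <= e) ->
  {for x, continuous h} -> is_derive x u g (h x).
Proof.
move=> oA Ax fg df Dfh /cvgrPdist_le ch.
suff : (fun t : R => t^-1 *: ((g \o shift x) (t *: u) - g x)) @ 0^' --> h x.
  by move=> H; split; [apply/cvg_ex; exists (h x)|exact: cvg_lim].
apply/cvgrPdist_le => e e0; have e2 : 0 < e / 2 by rewrite divr_gt0.
have [r r0 rP] := near_segment u
  (filterI (open_nbhs_nbhs (conj oA Ax)) (ch _ e2)).
near=> t.
have t0 : t != 0 by near: t; exact: nbhs_dnbhs_neq.
have tr : `|t| <= r by near: t; exact: dnbhs0_le.
rewrite /= [t *: u + x]addrC.
suff : `|g (x + t *: u) - g x - t * h x| <= e * `|t|.
  rewrite -ler_pdivrMr ?normr_gt0// -normfV -normrM distrC mulrBl.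
  by rewrite [t * _]mulrC mulfK// [_ * t^-1]mulrC.
have gt : f ^~ (x + t *: u) @ U --> g (x + t *: u).
  by apply: fg; exact: (rP t tr).1.
have gx := fg _ Ax.
apply: (cvgr_to_le (F := U)
    (f := fun i => `|f i (x + t *: u) - f i x - t * h x|)).
  by apply: cvg_norm; apply: cvgB; [exact: cvgB|exact: cvg_cst].
near=> i.
have [|s st ->] := @mvt_line (f i) x u t.
  by move=> s st; apply: df; apply: (rP s (le_trans st tr)).1.
have [As hs] := rP s (le_trans st tr).
rewrite -mulrBr normrM mulrC ler_wpM2r//.
have : `|'D_u (f i) (x + s *: u) - h (x + s *: u)| <= e / 2.
  by move: (x + s *: u) As {hs}; near: i; exact: Dfh.
move: hs => /=; rewrite !ler_norml => /andP[? ?] /andP[? ?]; apply/andP; lra.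
Unshelve. all: by end_near. Qed.

End directional_derivatives.

(** * Iterated partial derivatives do not depend on the order of differentiation *)

Section functions_on_closure.
Context {R : realType} {n : nat} (A : set 'rV[R]_n) (oA : open A).
Implicit Types (f g : closure A -> R) (F G : 'rV[R]_n -> R).

(** Since [A] is open, a relative neighborhood in [closure A] of a point of [A], cut down to [A], is
    a neighborhood in the whole space. *)
Lemma continuous_extension g G : continuous g ->
  (forall x : closure A, A (val x) -> g x = G (val x)) ->
  forall x, A x -> {for x, continuous G}.
Proof.
move=> cg gG x Ax V.
have cA y : A y -> y \in closure A by move=> Ay; apply/mem_set/subset_closure.
rewrite -(gG (SigSub (cA x Ax)) Ax) => /cg[W [[O oO OW] Wx WV]].
have Ox : O x by rewrite -OW in Wx.
apply: filterS (filterI (open_nbhs_nbhs (conj oO Ox))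
  (open_nbhs_nbhs (conj oA Ax))).
move=> y [Oy Ay] /=; rewrite -(gG (SigSub (cA y Ay)) Ay).
by apply: WV; rewrite -OW.
Qed.

Variables (m : nat) (F : 'rV[R]_n -> R).
Hypothesis cF : forall s : seq 'I_n, (size s <= m)%N ->
  extends_to_closure A (iter_partial s F) /\
  ((size s < m)%N -> forall i x, A x ->
     derivable (iter_partial s F) x (delta_mx ord0 i)).

Let iter_partial_swap i j s x : ((size s).+2 <= m)%N -> A x ->
  iter_partial [:: i, j & s] F x = iter_partial [:: j, i & s] F x.
Proof.
move=> sm Ax; apply: derive_comm.
- have [_ ds] := cF (ltnW (ltnW sm)).
  have [_ dj] := @cF (j :: s) (ltnW sm); have [_ di] := @cF (i :: s) (ltnW sm).
  apply: filterS (open_nbhs_nbhs (conj oA Ax)) => y Ay.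
  by split; [exact: ds (ltnW sm) _ _ Ay|exact: ds (ltnW sm) _ _ Ay|
    exact: dj|exact: di].
- by have [[g cg gF] _] := @cF [:: i, j & s] sm;
     apply: (continuous_extension cg gF).
- by have [[g cg gF] _] := @cF [:: j, i & s] sm;
     apply: (continuous_extension cg gF).
Qed.

Let iter_partial_move i s t x : (size (s ++ t) < m)%N -> A x ->
  iter_partial (s ++ i :: t) F x = iter_partial (i :: s ++ t) F x.
Proof.
elim: s x => [//|j s IH] x sm Ax.
rewrite -iter_partial_swap//.
apply: (eq_iter_partial oA [:: j]) Ax => y Ay.
by apply: IH => //; exact: ltnW.
Qed.

(** The head of [s] is located in [t], brought to the front by adjacent swaps, and removed from
    both. *)
Lemma iter_partial_perm s t x : perm_eq s t -> (size s <= m)%N -> A x ->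
  iter_partial s F x = iter_partial t F x.
Proof.
elim: s t x => [|i s IH] t x; first by rewrite perm_sym => /perm_nilP ->.
move=> st sm Ax; have it : i \in t by rewrite -(perm_mem st) mem_head.
case: (path.splitPr it) st => t1 t2 st.
have {}st : perm_eq s (t1 ++ t2).
  by rewrite -(perm_cons i) (perm_trans st)// -cat1s perm_catCA.
rewrite iter_partial_move//; last by rewrite -(perm_size st).
apply: (eq_iter_partial oA [:: i]) Ax => y Ay.
by apply: IH => //; exact: ltnW.
Qed.

End functions_on_closure.

Lemma partial_seq_perm {R : realType} {n : nat} (A : set 'rV[R]_n) m
    (f : closure A -> R) (s t : seq 'I_n) : open A -> Cm m f ->
  perm_eq s t -> (size s <= m)%N -> partial_seq s f = partial_seq t f.
Proof.
move=> oA cf st sm; have tm : (size t <= m)%N by rewrite -(perm_size st).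
have [ct pt] := Cm_partial_seq cf tm.
apply: partial_seq_uniq => // x Ax; rewrite pt//.
by apply/esym; apply: (iter_partial_perm oA cf.2).
Qed.

(** The multi-index records the multiplicities of the directions in [s]. Together with symmetry, it
    reduces every iterated derivative to some [partial p]. *)
Lemma multiindex_of_seq n m (s : seq 'I_n) : (size s <= m)%N ->
  exists p : multiindex n m, perm_eq s (directions p).
Proof.
move=> sm; have cm i : (count_mem i s < m.+1)%N.
  by rewrite ltnS (leq_trans (count_size _ _)).
have sumE : (\sum_i count_mem i s = size s)%N.
  elim: s {sm cm} => [|j s IH] /=; first by rewrite big1.
  by rewrite big_split/= IH (bigD1 j)//= eqxx big1 ?addn0// => i /negPf;
     rewrite eq_sym => ->.
pose p : {ffun 'I_n -> 'I_m.+1} := [ffun i => Ordinal (cm i)].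
have pm : (\sum_i p i <= m)%N.
  by under eq_bigr do rewrite ffunE/=; rewrite sumE.
exists (exist (fun p : {ffun 'I_n -> 'I_m.+1} => (\sum_i p i <= m)%N) p pm).
apply/allP => j _; apply/eqP => /=.
rewrite /directions count_flatten -map_comp sumnE big_map big_enum/=.
rewrite (bigD1 j)//=.
rewrite count_nseq ffunE/= eqxx mul1n big1 ?addn0// => i /negPf.
by rewrite count_nseq /= => ->.
Qed.

(** Compactness of [[-M, M]] gives a cluster point, and an ultrafilter converges to its cluster
    points because it decides every preimage. *)
Lemma ultra_cvg_bounded {R : realType} {T : Type} (U : set_system T)
    {UU : UltraFilter U} (f : T -> R) (M : R) :
  (\forall i \near U, `|f i| <= M) -> cvg (f @ U).
Proof.
move=> fM; have [|l [_ lU]] := @segment_compact R (- M) M (f @ U) _.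
  by apply: filterS fM => i; rewrite /= in_itv/= ler_norml.
apply/cvg_ex; exists l => V lV.
have [//|UnV] := in_ultra_setVsetC (f @^-1` V) UU.
by have [r [nVr Vr]] := lU (~` V) V UnV lV.
Qed.

(** * Functions on a space with a compactification; Ascoli along an ultrafilter *)

Section compactifications.
Context {S Y : topologicalType} {kappa : S -> Y}.
Hypothesis kappaP : compactification kappa.

(** This is continuity of the inverse of [kappa] on its range. Points outside the range satisfy the
    condition vacuously, so the set is a neighborhood in [Y] itself. *)
Lemma nbhs_compactification a (V : set S) : nbhs a V ->
  nbhs (kappa a) [set y | forall b, kappa b = y -> V b].
Proof.
have [_ _ [_ [g cg gk]]] := kappaP.
have rk b : kappa b \in range kappa by apply/mem_set; exists b.
rewrite -{1}(gk a (SigSub (rk a)) erefl) => /cg [W [[O oO OW] Wx WV]].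
have Oa : O (kappa a) by rewrite -OW in Wx.
apply: filterS (open_nbhs_nbhs (conj oO Oa)) => y Oy b yb; rewrite -{y}yb in Oy.
by have := WV (SigSub (rk b)); rewrite -OW/= (gk b)//; exact.
Qed.

Lemma near_compactification {T : Type} (U : set_system T) {UF : Filter U}
    (P : T -> S -> Prop) :
  (forall x : Y, \forall y \near x & i \near U,
    forall b, kappa b = y -> P i b) ->
  \forall i \near U, forall b, P i b.
Proof.
move=> xP; have [cY _ _] := kappaP.
have : \forall i \near U, [set: Y] `<=` fun y => forall b, kappa b = y -> P i b.
  by move/compact_near_coveringP : cY; apply.
by apply: filterS => i iP b; exact: (iP (kappa b)).
Qed.

Lemma compactification_meets (x : Y) (V : set Y) : nbhs x V ->
  exists a, V (kappa a).
Proof.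
have [_ dk _] := kappaP; rewrite nbhsE => -[O [oO Ox] OV].
have [|y [Oy [a _ ay]]] := dk O _ oO; first by exists x.
by exists a; apply: OV; rewrite ay.
Qed.

(** Density makes preimages of neighborhoods nonempty; deleting [x] costs nothing since [x] is not
    attained. *)
Lemma kappa_nbhs_proper (x : Y) : ~ range kappa x ->
  ProperFilter (kappa_nbhs kappa x).
Proof.
move=> kx; apply: Build_ProperFilter => -[V /compactification_meets[a Va]].
by move/(_ a); apply; split => // ax; apply: kx; exists a.
Qed.

Lemma compactification_bounded {R : realType} (h : S -> R) : continuous h ->
  (forall x : Y, ~ range kappa x -> cvg (h @ kappa_nbhs kappa x)) ->
  exists M, forall a, `|h a| <= M.
Proof.
move=> ch lh.
have nbhsl (l : R) : nbhs l [set r : R | `|r| <= `|l| + 1].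
  apply/nbhs_ballP; exists 1 => //= r /ltW lr /=.
  by rewrite -lerBlDl (le_trans (lerB_dist _ _))// distrC.
have loc (x : Y) : exists M,
    \forall y \near x, forall b, kappa b = y -> `|h b| <= M.
  have [[a _ <-]|kx] := pselect (range kappa x).
    by exists (`|h a| + 1); apply: nbhs_compactification;
       exact: (ch a _ (nbhsl _)).
  have /cvg_ex[l hl] := lh x kx; exists (`|l| + 1).
  have [V nV VM] := hl _ (nbhsl l).
  apply: filterS nV => y Vy b by_; apply: VM; split; first by rewrite /= by_.
  by move=> bx; apply: kx; exists b.
(* Letting the bound itself run along [+oo] makes compactness combine the local bounds.
   Neighborhoods of [+oo] are given by strict inequalities, hence [M + 1]. *)
have [M [_ /(_ (M + 1)) hM]] : \forall M \near +oo, forall b, `|h b| <= M.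
  apply: near_compactification => x; have [M nM] := loc x.
  exists ([set y | forall b, kappa b = y -> `|h b| <= M],
    [set r | M <= r]) => /=.
    by split => //; apply: nbhs_pinfty_ge; exact: num_real.
  by move=> [y r] /= [yM Mr] b by_; rewrite (le_trans _ Mr)// yM.
by exists (M + 1); apply: hM; rewrite ltrDl.
Qed.

(** The oscillation hypothesis treats points of [kappa]'s range and points at infinity alike. The
    limit inherits it, which yields continuity at the former and the Cauchy property at the
    latter. *)
Lemma ultra_ascoli {R : realType} {T : Type} (U : set_system T)
    {UU : UltraFilter U} (f : T -> S -> R) :
  (forall a, exists M, \forall i \near U, `|f i a| <= M) ->
  (forall (x : Y) (e : R), 0 < e -> exists2 V, nbhs x V & \forall i \near U,
    forall a b, V (kappa a) -> V (kappa b) -> `|f i a - f i b| <= e) ->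
  exists h : S -> R, [/\ forall a, f ^~ a @ U --> h a,
    forall e : R, 0 < e -> \forall i \near U, forall a, `|f i a - h a| <= e,
    continuous h &
    forall x : Y, ~ range kappa x -> cvg (h @ kappa_nbhs kappa x)].
Proof.
move=> fM fV; pose h a := lim (f ^~ a @ U).
have fh a : f ^~ a @ U --> h a.
  by have [M aM] := fM a; exact: ultra_cvg_bounded aM.
have hV (x : Y) (e : R) : 0 < e -> exists2 V, nbhs x V &
    forall a b, V (kappa a) -> V (kappa b) -> `|h a - h b| <= e.
  move=> /(fV x)[V nV UV]; exists V => // a b Va Vb.
  apply: (cvgr_to_le (F := U) (f := fun i => `|f i a - f i b|)).
    by apply: cvg_norm; exact: cvgB.
  by apply: filterS UV => i /(_ a b Va Vb).
exists h; split => //.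
- move=> e e0; have e3 : 0 < e / 3 by rewrite divr_gt0.
  apply: near_compactification => x.
  have [V nV UV] := fV x _ e3; have [W nW hW] := hV x _ e3.
  (* Pointwise convergence at this single [a] controls every [b] near [x], as [f i] and [h] both
     oscillate by at most [e / 3] there. *)
  have [a [Va Wa]] := compactification_meets (filterI nV nW).
  have /cvgrPdist_le/(_ _ e3) fa := fh a.
  exists (V `&` W, [set i | (forall a b, V (kappa a) -> V (kappa b) ->
      `|f i a - f i b| <= e / 3) /\ `|h a - f i a| <= e / 3]).
    by split; [exact: filterI|exact: filterI].
  move=> [y i] /= [[Vy Wy] [/(_ a) fab hfa]] b by_; rewrite -{y}by_ in Vy Wy.
  move: (fab b Va Vy) (hW a b Wa Wy) hfa; rewrite !ler_norml.
  by move=> /andP[? ?] /andP[? ?] /andP[? ?]; apply/andP; lra.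
- have [_ _ [ck _]] := kappaP.
  move=> a; apply/cvgrPdist_le => e e0.
  have [V nV Vh] := hV (kappa a) _ e0.
  have aV : nbhs a (kappa @^-1` V) by exact: ck.
  apply: filterS aV => b Vb.
  by apply: Vh => //; exact: nbhs_singleton.
- move=> x kx; have kF := kappa_nbhs_proper kx.
  apply/cauchy_cvgP/cauchy_exP => e e0.
  have e2 : 0 < e / 2 by rewrite divr_gt0.
  have [V nV Vh] := hV x _ e2.
  have [a Va] := compactification_meets nV.
  exists (h a); exists V => // b [Vb _].
  by apply: le_lt_trans (Vh a b Va Vb) _; lra.
Qed.

End compactifications.

(** * Limits and products in C^m, and the Euclidean norm *)

(** The candidates [h s] are indexed by ordered sequences, as in [Cm]; [is_derive_limit] links
    [h (j :: s)] to [h s], and induction on [s] identifies each with a derivative of [h [::]]. *)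
Lemma Cm_limit {R : realType} {n : nat} (A : set 'rV[R]_n) m {T : Type}
    (U : set_system T) {UF : ProperFilter U} (f : T -> closure A -> R)
    (h : seq 'I_n -> closure A -> R) : open A ->
  (forall i, Cm m (f i)) ->
  (forall s, (size s <= m)%N -> continuous (h s)) ->
  (forall s, (size s <= m)%N -> forall e : R, 0 < e ->
    \forall i \near U, forall a, `|partial_seq s (f i) a - h s a| <= e) ->
  Cm m (h [::]) /\
  forall s, (size s <= m)%N -> partial_seq s (h [::]) = h s.
Proof.
move=> oA cf ch fh.
have cA y : A y -> y \in closure A by move=> Ay; apply/mem_set/subset_closure.
have valL (g : closure A -> R) y (Ay : A y) :
    'valL_0 g y = g (SigSub (cA y Ay)) by rewrite -valL0E.
have iterE i s y (Ay : A y) : (size s <= m)%N ->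
    iter_partial s ('valL_0 (f i)) y = partial_seq s (f i) (SigSub (cA y Ay)).
  by move=> sm; have [_ ->] := Cm_partial_seq (cf i) sm.
have dh s j x : (size s < m)%N -> A x -> is_derive x (delta_mx ord0 j)
    ('valL_0 (h s)) ('valL_0 (h (j :: s)) x).
  move=> sm Ax; apply: (is_derive_limit (U := U)
    (f := fun i => iter_partial s ('valL_0 (f i))) oA Ax).
  - move=> y Ay; rewrite (valL (h s) y Ay).
    apply/cvgrPdist_le => e e0.
    apply: filterS (fh s (ltnW sm) e e0) => i /(_ (SigSub (cA y Ay))).
    by rewrite distrC (iterE i s y Ay)// ltnW.
  - by move=> i y Ay; apply: ((cf i).2 s (ltnW sm)).2.
  - move=> e e0; apply: filterS (fh (j :: s) sm e e0) => i fhi y Ay.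
    have := fhi (SigSub (cA y Ay)).
    by rewrite -(iterE i (j :: s) y Ay)// (valL (h (j :: s)) y Ay).
  - apply: (continuous_extension oA (ch (j :: s) sm)) Ax => y Ay.
    by rewrite valL0E.
have hE s x : (size s <= m)%N -> A x ->
    iter_partial s ('valL_0 (h [::])) x = 'valL_0 (h s) x.
  elim: s x => [//|j s IH] x sm Ax.
  have [_ <-] := dh s j x sm Ax.
  apply: (@eq_iter_partial _ _ _ oA [:: j] (iter_partial s _)) Ax => y Ay.
  by rewrite IH// ltnW.
split.
  split; first exact: ch.
  move=> s sm; split.
    by exists (h s); [exact: ch|move=> x Ax; rewrite hE// valL0E].
  move=> {}sm j x Ax; have [dhs _] := dh s j x sm Ax.
  apply: near_eq_derivable dhs.
  by apply: filterS (open_nbhs_nbhs (conj oA Ax)) => y Ay; rewrite hE// ltnW.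
move=> s sm; apply: partial_seq_uniq; first exact: ch.
by move=> x Ax; rewrite hE// valL0E.
Qed.

Lemma Cm_mul {R : realType} {n : nat} (A : set 'rV[R]_n) m
    (f g : closure A -> R) : open A -> Cm m f -> Cm m g ->
  Cm m (fun x => f x * g x).
Proof.
move=> oA; rewrite !Cm_smooth => -[cf sf] [cg sg]; split.
  by move=> x; exact: cvgM (cf x) (cg x).
apply: (eq_smooth oA) (smoothM oA sf sg) => x Ax.
rewrite [RHS](@valL0_eq _ _ _ _ (fun x => 'valL_0 f x * 'valL_0 g x))// => y.
by rewrite !valL0E.
Qed.

(** Links the Euclidean distance of the second condition to the topology of [closure A]. *)
Lemma near_euclidean_norm {R : realType} {n : nat} (A : set 'rV[R]_n)
    (a : closure A) (d : R) : 0 < d ->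
  \forall b \near a, euclidean_norm (val a - val b) < d.
Proof.
move=> d0.
have ci i : continuous (fun v : 'rV[R]_n => (val a - v) ord0 i ^+ 2).
  have -> : (fun v : 'rV[R]_n => (val a - v) ord0 i ^+ 2) =
      (fun v => (val a ord0 i - v ord0 i) * (val a ord0 i - v ord0 i)).
    by apply/funext => v; rewrite !mxE.
  have cB : continuous (fun v : 'rV[R]_n => val a ord0 i - v ord0 i).
    by move=> v; exact: cvgB (cvg_cst _) (@coord_continuous _ _ _ _ _ v).
  by move=> v; exact: cvgM (cB v) (cB v).
have cs : continuous (fun v : 'rV[R]_n => \sum_i (val a - v) ord0 i ^+ 2).
  by apply: continuous_big => [|i _]; [exact: add_continuous|exact: ci].
have c : continuous (fun v : 'rV[R]_n => euclidean_norm (val a - v)).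
  by move=> v; exact: (cvg_comp _ _ (cs v) (@sqrt_continuous R _)).
have cv : continuous (val : closure A -> 'rV[R]_n) by exact: initial_continuous.
have h0 : euclidean_norm (val a - val a) = 0.
  rewrite /euclidean_norm subrr big1 ?sqrtr0// => i _.
  by rewrite mxE expr0n.
have ca : euclidean_norm (val a - val b) @[b --> a] --> (0 : R).
  by rewrite -h0; exact: (cvg_comp _ _ (cv a) (c (val a))).
exact: (cvgr_lt _ ca _ d0).
Qed.

(** * The norm of the weighted space and the derivatives of the quotients *)

Section Ckphi_theory.
Context {R : realType} {n m : nat} {A : set 'rV[R]_n} {X : metricType R}.
Context {kappa : closure A -> X} {phi : closure A -> R}.
Variables (oA : open A) (kappaP : compactification kappa)
  (phiP : Cm_pos m phi).
Implicit Types f g : Ckphi oA kappaP phiP.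

Lemma CkphiP f : Cm m f /\ forall x : X, ~ range kappa x ->
  forall p : multiindex n m,
    cvg (partial p (fun y => f y / phi y) @ kappa_nbhs kappa x).
Proof. by case: f => f /= /set_mem. Qed.

Lemma Cm_quotient f : Cm m (fun y => f y / phi y).
Proof. exact: (Cm_div oA (CkphiP f).1 phiP). Qed.

Lemma partial_quotientB f g (p : multiindex n m) a :
  partial p (fun y => (f - g) y / phi y) a =
  partial p (fun y => f y / phi y) a - partial p (fun y => g y / phi y) a.
Proof.
have -> : (fun y => (f - g) y / phi y) =
    (fun y => -1 * (g y / phi y) + f y / phi y).
  by apply/funext => y; rewrite mulN1r [RHS]addrC -mulrBl.
rewrite /partial (partial_seqZD oA _ (Cm_quotient g) (Cm_quotient f)).
  by rewrite mulN1r addrC.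
exact: size_directions.
Qed.

Lemma partial_le_norm f (p : multiindex n m) a :
  `|partial p (fun y => f y / phi y) a| <= `|f|.
Proof.
(* Boundedness must come first: [sup] of an unbounded set is 0 by default. *)
have [cp _] := Cm_partial_seq (Cm_quotient f) (size_directions p).
have [M fM] := compactification_bounded kappaP cp
  (fun x kx => (CkphiP f).2 x kx p).
apply: (@le_trans _ _ (supnorm (partial p (fun y => f y / phi y)))).
  apply: ub_le_sup; first by exists M => _ [y _ <-]; exact: fM.
  by exists a.
exact: le_bigmax.
Qed.

Lemma norm_le_partial f (M : R) : 0 <= M ->
  (forall (p : multiindex n m) a, `|partial p (fun y => f y / phi y) a| <= M) ->
  `|f| <= M.
Proof.
move=> M0 fM; apply: bigmax_le => // p _.
have [[a]|/nonemptyPn A0] := pselect ([set: closure A] !=set0).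
  by move=> _; apply: ge_sup => [|_ [y _ <-]//];
     exists `|partial p (fun y => f y / phi y) a|, a.
(* On an empty closure the supremum takes the default value 0, covered by [0 <= M]. *)
by rewrite /supnorm A0 image_set0 sup0.
Qed.

Lemma partial_closure (F : set (Ckphi oA kappaP phiP)) f (e : R) :
  closure F f -> 0 < e -> exists2 g, F g & forall (p : multiindex n m) a,
    `|partial p (fun y => f y / phi y) a - partial p (fun y => g y / phi y) a|
      <= e.
Proof.
move=> /[swap] e0 /(_ _ (nbhsx_ballx f e e0))[g [Fg]].
rewrite -ball_normE/= => /ltW fg; exists g => // p a.
by rewrite -partial_quotientB (le_trans (partial_le_norm _ _ _)).
Qed.

End Ckphi_theory.

(** * Relative compactness in the weighted space *)

Theorem theorem3p9 (R : realType) (n m : nat) (n_gt0 : (0 < n)%N)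
    (m_gt0 : (0 < m)%N) (A : set 'rV[R]_n) (oA : open A) (cA : connected A)
    (uA : ~ bounded_set A) (X : metricType R) (kappa : closure A -> X)
    (kappaP : compactification kappa) (phi : closure A -> R)
    (phiP : Cm_pos m phi) (F : set (Ckphi oA kappaP phiP))
    (bounded_pointwise : forall (x : closure A) (p : multiindex n m),
      exists2 M : R, 0 < M & forall f : Ckphi oA kappaP phiP, F f ->
        `|partial p (fun z => f z / phi z) x| <= M)
    (equicontinuous_inside :
      forall (x : closure A) (eps : R) (p : multiindex n m), 0 < eps ->
      exists2 delta : R, 0 < delta &
        forall (f : Ckphi oA kappaP phiP) (y : closure A), F f ->
          euclidean_norm (val x - val y) < delta ->
          `|partial p (fun z => f z / phi z) x -
            partial p (fun z => f z / phi z) y| < eps)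
    (equicontinuous_at_infinity :
      forall (x : X) (eps : R) (p : multiindex n m),
      ~ range kappa x -> 0 < eps ->
      exists2 delta : R, 0 < delta &
        forall (f : Ckphi oA kappaP phiP) (y : closure A), F f ->
          mdist x (kappa y) < delta ->
          `|lim (partial p (fun z => f z / phi z) @ kappa_nbhs kappa x) -
            partial p (fun z => f z / phi z) y| < eps) :
  compact (closure F).
Proof.
have osc (p : multiindex n m) (x : X) (e : R) : 0 < e -> exists2 V, nbhs x V &
    forall f : Ckphi oA kappaP phiP, F f -> forall a b,
    V (kappa a) -> V (kappa b) ->
    `|partial p (fun z => f z / phi z) a - partial p (fun z => f z / phi z) b|
      <= e.
  move=> e0; have e2 : 0 < e / 2 by rewrite divr_gt0.
  (* Conditions 2 and 3 share this form: [l f] is the value at the point, or the limit at infinity.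
     Comparing two points through [l f] costs [e / 2] twice. *)
  suff [V nV [l Vl]] : exists2 V, nbhs x V & exists l, forall f, F f ->
      forall a, V (kappa a) ->
      `|l f - partial p (fun z => f z / phi z) a| <= e / 2.
    exists V => // f Ff a b Va Vb.
    exact: ler_dist2 (Vl f Ff a Va) (Vl f Ff b Vb).
  have [[c _ <-]|kx] := pselect (range kappa x).
    have [d d0 Fd] := equicontinuous_inside c _ p e2.
    have nV := nbhs_compactification kappaP (near_euclidean_norm c d0).
    exists [set y | forall b, kappa b = y ->
        euclidean_norm (val c - val b) < d].
      exact: nV.
    exists (fun f => partial p (fun z => f z / phi z) c) => f Ff a Va.
    by apply/ltW/Fd => //; exact: Va.
  have [d d0 Fd] := equicontinuous_at_infinity x _ p kx e2.
  exists (ball x d); first exact: nbhsx_ballx.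
  exists (fun f => lim (partial p (fun z => f z / phi z) @ kappa_nbhs kappa x)).
  by move=> f Ff a; rewrite ballEmdist => xa; exact/ltW/Fd.
rewrite compact_ultra => U UU UF.
have asc (p : multiindex n m) : exists h : closure A -> R, [/\ continuous h,
    forall e : R, 0 < e -> \forall f \near U, forall a,
      `|partial p (fun z => Ckphi_fun f z / phi z) a - h a| <= e &
    forall x : X, ~ range kappa x -> cvg (h @ kappa_nbhs kappa x)].
  have [||h [_ ? ? ?]] := @ultra_ascoli _ _ _ kappaP R _ U UU
    (fun f a => partial p (fun z => f z / phi z) a); last by exists h.
  (* [U] contains the closure of [F] only, so [f] is replaced by some [g] in [F] within distance
     1. *)
  - move=> a; have [M M0 FM] := bounded_pointwise a p; exists (M + 1).
    apply: filterS UF => f /partial_closure/(_ ltr01)[g Fg /(_ p a) fg].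
    rewrite -lerBlDl; apply: le_trans fg.
    rewrite (le_trans _ (lerB_dist _ _))//.
    by rewrite lerB// FM.
  - move=> x e e0; have e3 : 0 < e / 3 by rewrite divr_gt0.
    have [V nV FV] := osc p x _ e3; exists V => //.
    apply: filterS UF => f /partial_closure/(_ e3)[g Fg fg] a b Va Vb.
    exact: ler_dist3 (fg p a) (fg p b) (FV g Fg a b Va Vb).
have /choice[h hP] : forall s : seq 'I_n, exists h : closure A -> R,
    (size s <= m)%N -> [/\ continuous h,
    forall e : R, 0 < e -> \forall f \near U, forall a,
      `|partial_seq s (fun z => Ckphi_fun f z / phi z) a - h a| <= e &
    forall x : X, ~ range kappa x -> cvg (h @ kappa_nbhs kappa x)].
  (* Choice needs a value for every [s]; beyond order [m] it is arbitrary. *)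
  move=> s; have [sm|] := leqP (size s) m; last by exists (fun=> 0).
  have [p sp] := multiindex_of_seq sm; have [h [ch Uh lh]] := asc p.
  exists h => _; split => // e /Uh; apply: filterS => f fh a.
  by rewrite (partial_seq_perm oA (Cm_quotient f) sp sm); exact: fh.
have [Ch ph] : Cm m (h [::]) /\
    forall s, (size s <= m)%N -> partial_seq s (h [::]) = h s.
  apply: (@Cm_limit _ _ _ m _ U _ (fun f z => f z / phi z)) => //.
  - by move=> f; exact: Cm_quotient.
  - by move=> s /hP[].
  - by move=> s /hP[].
(* [h [::]] is the limit of the quotients, so multiplying by [phi] recovers the limit function. *)
pose g z := h [::] z * phi z.
have gphi : (fun z => g z / phi z) = h [::].
  by apply/funext => z; rewrite /g mulfK// gt_eqF//; exact: phiP.2.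
have gP : g \in Ckphi_set oA kappaP phiP.
  apply/mem_set; split; first exact: Cm_mul oA Ch phiP.1.
  move=> x kx p; rewrite gphi /partial ph ?size_directions//.
  by have [_ _] := hP _ (size_directions p); exact.
have Ug : U --> MkCkphi gP.
  apply/cvgrPdist_le => e e0.
  have : \forall f \near U, forall (p : multiindex n m) a,
      `|partial p (fun z => Ckphi_fun f z / phi z) a - h (directions p) a| <= e.
    (* There are finitely many multi-indices, so one set of [U] serves all of them. *)
    apply: filter_forall => p.
    by have [_ + _] := hP _ (size_directions p); exact.
  apply: filterS => f fh; apply: norm_le_partial; first exact: ltW.
  move=> p a; rewrite partial_quotientB distrC /= gphi.
  by rewrite {2}/partial ph ?size_directions.
exists (MkCkphi gP); split => //.
(* The limit lies in [closure F] because this set is closed and belongs to [U]. *)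
rewrite ((closure_id _).1 (@closed_closure _ F)) => B /Ug UB.
exact: filter_ex (filterI UF UB).
Qed.
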